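(* Let $\beta\in(1,2)$ be a Garsia number. Then $\beta$ is approximation regular. That is, for every function $\Psi:\mathbb{N}\to\mathbb{R}_{\geq 0}$ satisfying $\sum_{n=1}^{\infty}2^{n}\Psi(n)=\infty$, the set $W_{\beta}(\Psi)$ has full Lebesgue measure within $I_{\beta}$, i.e. Lebesgue almost every $x\in I_\beta$ belongs to $W_\beta(\Psi)$.
   Context: $\mathbb{N}=\{1,2,3,\ldots\}$. For $\beta\in(1,2)$ let $I_{\beta}:=[0,\frac{1}{\beta-1}]$. For $\Psi:\mathbb{N}\to\mathbb{R}_{\geq 0}$ (no monotonicity is assumed) define $$W_{\beta}(\Psi):=\bigcap_{m=1}^{\infty}\bigcup_{n=m}^{\infty}\bigcup_{(\epsilon_{i})_{i=1}^{n}\in\{0,1\}^{n}}\Big[\sum_{i=1}^{n}\frac{\epsilon_{i}}{\beta^{i}},\ \sum_{i=1}^{n}\frac{\epsilon_{i}}{\beta^{i}}+\Psi(n)\Big],$$ i.e. the set of $x\in\mathbb{R}$ such that for infinitely many $n\in\mathbb{N}$ there exists $(\epsilon_i)_{i=1}^n\in\{0,1\}^n$ with $0\leq x-\sum_{i=1}^{n}\epsilon_{i}\beta^{-i}\leq\Psi(n)$. A number $\beta\in(1,2)$ is called approximation regular if for each $\Psi:\mathbb{N}\to\mathbb{R}_{\geq 0}$ satisfying $\sum_{n=1}^{\infty}2^{n}\Psi(n)=\infty$, the set $W_{\beta}(\Psi)$ has full Lebesgue measure within $I_{\beta}$. A Garsia number is a positive real algebraic integer with norm $\pm 2$ whose conjugates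 all have modulus strictly greater than $1$ (the norm of an algebraic integer is the product of it with all of its other Galois conjugates). *)

(* Defs.v *)
From HB Require Import structures.
From mathcomp Require Import all_boot all_order all_algebra.
From mathcomp Require Import complex.
From mathcomp Require Import all_classical all_reals all_analysis.

Set Implicit Arguments.
Unset Strict Implicit.
Unset Printing Implicit Defensive.

Import Order.TTheory GRing.Theory Num.Theory.
Import numFieldNormedType.Exports.

Local Open Scope classical_set_scope.
Local Open Scope ring_scope.
Local Open Scope complex_scope.

Definition is_min_poly (R : realType) (beta : R) (p : {poly rat}) : Prop :=
  [/\ p \is monic, irreducible_poly p & root (map_poly ratr p) beta].

(* [s] lists the Galois conjugates of [beta], including [beta] itself, i.e. the
   complex roots of its minimal polynomial over the rationals; these are simple,
   so [s] has no repetitions and is unique up to permutation. *)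
Definition galois_conjugates (R : realType) (beta : R) (s : seq R[i]) : Prop :=
  exists2 p : {poly rat}, is_min_poly beta p &
    map_poly ratr p = \prod_(z <- s) ('X - z%:P).

(* The modulus of [z : R[i]] lies in [R[i]] as well, so the last inequality is
   taken in the partial order of [R[i]]. It also covers [beta] itself. *)
Definition garsia_number (R : realType) (beta : R) : Prop :=
  [/\ 0 < beta, integralOver (intr : int -> R) beta &
    exists s : seq R[i],
      [/\ galois_conjugates beta s,
          \prod_(z <- s) z = 2 \/ \prod_(z <- s) z = - 2 &
          forall z, z \in s -> 1 < `|z|]].

Definition I_beta (R : realType) (beta : R) : set R :=
  `[0, (beta - 1)^-1]%classic.

(* The digit epsilon_(i+1) of the usual 1-based notation is [eps i]. *)
Definition digit_sum (R : realType) (beta : R) (n : nat)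
    (eps : {ffun 'I_n -> bool}) : R :=
  \sum_(i < n) (eps i)%:R / beta ^+ i.+1.

Definition W (R : realType) (beta : R) (Psi : nat -> R) : set R :=
  \bigcap_(m in [set m | (1 <= m)%N])
  \bigcup_(n in [set n | (m <= n)%N])
  \bigcup_(eps in [set: {ffun 'I_n -> bool}])
    `[digit_sum beta eps, digit_sum beta eps + Psi n]%classic.

(* Functions on the positive integers are functions on [nat] whose value at 0
   is unconstrained and never used. *)
Definition approximation_regular (R : realType) (beta : R) : Prop :=
  forall Psi : nat -> R,
    (forall n, (1 <= n)%N -> 0 <= Psi n) ->
    (\sum_(1 <= n <oo) (2 ^+ n * Psi n)%:E = +oo)%E ->
    {ae (@lebesgue_measure R), forall x, I_beta beta x -> W beta Psi x}.

(* Main.v *)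
Require Import Defs.
From mathcomp Require Import all_boot all_order all_algebra.
From mathcomp Require Import ring lra.
From mathcomp Require Import complex.
From mathcomp Require Import all_classical all_reals all_analysis.

(** Separation.  Let [e <> e'] be two 0-1 words of length [n].  Up to the
    factor [beta ^- n], the difference of their digit sums is [P(beta)] for a
    nonzero integer polynomial [P] of degree less than [n] whose coefficients
    are -1, 0 or 1.  The minimal polynomial [p] of [beta] has constant term
    2 or -2, so it cannot divide [P]: the lowest nonzero coefficient of [P]
    would be even.  Hence the product of [P(z)] over the conjugates [z] of
    [beta] is a nonzero integer.  Each factor with [z <> beta] is at most
    [|z|^n / (|z| - 1)] and the product of all the [|z|] is 2, which leaves
    [|P(beta)| >= C (beta / 2)^n].  So the [2^n] digit sums of level [n] are
    [C / 2^n]-separated ([garsia_separation]): they are as evenly spread, up to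
    a constant, as so many points of a bounded interval can be.

    Positive measure.  Let [X n] be sets of [2^n] points of a bounded interval,
    [b / 2^n]-separated, let [psi n <= b / 2^(n+1)] and let the sum of
    [2^n psi n] diverge.  The limsup set of the intervals [[x, x + psi n]],
    [x] in [X n], then has measure at least [b / 72] ([measure_limsup_ge]).
    By separation, an interval of length [l] from an earlier level meets at
    most [2 + 2 l 2^n / b] intervals of level [n].  As long as the intervals
    used so far have total length at most [b / 12], the second terms add up to
    at most [2^n / 6]; if only levels of one parity are used, the first terms
    add up to at most [2 (2^n / 3)].  So at least [2^n / 6] of the intervals of
    level [n] are disjoint from all the earlier ones, and the measure of the
    union keeps growing until it reaches [b / 72].

    Full measure.  The previous bound is scale invariant.  Fix a word [w] of
    length [k].  The digit sums of the words of length [k + n] that extend [w]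
    form a copy of the digit sums of level [n] contracted by [beta ^- k], hence
    are [b / 2^n]-separated with [b = C / beta^k].  So [W beta Psi] contains a
    set of measure at least [C / (72 beta^k)] in an interval whose length is a
    constant times [beta ^- k] ([W_in_cylinder]).  Because [beta <= 2], such
    intervals contain every point of [I_beta] at every scale, so no point of
    [I_beta] outside [W beta Psi] is a density point of the complement, and the
    Lebesgue density theorem concludes. *)

Set Implicit Arguments.
Unset Strict Implicit.
Unset Printing Implicit Defensive.

Import Order.TTheory GRing.Theory Num.Theory.
Import numFieldNormedType.Exports.
Local Open Scope classical_set_scope.
Local Open Scope ring_scope.

(** * Values of integer polynomials at the conjugates of an algebraic integer *)

(** Both sides equal a power of the leading coefficient of [P] times the product
    of [z - w] over the roots [z] of the characteristic polynomial and the roots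
    [w] of [P]: a resultant. *)
Lemma det_horner_mx (F : closedFieldType) (d : nat) (A : 'M[F]_d.+1)
    (s : seq F) (P : {poly F}) :
  char_poly A = \prod_(z <- s) ('X - z%:P) ->
  \det (horner_mx A P) = \prod_(z <- s) P.[z].
Proof.
move=> As; have szs : size s = d.+1.
  by apply/succn_inj; rewrite -(size_char_poly A) As size_prod_XsubC.
have exp_d (c : F) : c ^+ d.+1 = \prod_(z <- s) c.
  by rewrite big_const_seq count_predT szs iter_mulr_1.
have det_sub w : \det (w%:M - A) = \prod_(z <- s) (w - z).
  transitivity (char_poly A).[w].
    rewrite -horner_evalE /char_poly -det_map_mx; congr (\det _).
    apply/matrixP => i j; rewrite !mxE.
    by rewrite -[RHS]/(('X *+ (i == j) - (A i j)%:P).[w]) !hornerE hornerMn hornerX.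
  by rewrite As horner_prod; apply: eq_bigr => z _; rewrite !hornerE.
have [r ->] := closed_field_poly_normal P.
rewrite horner_mxZ detZ rmorph_prod /=.
have -> : \det (\prod_(w <- r) horner_mx A ('X - w%:P)) =
          \prod_(w <- r) \prod_(z <- s) (z - w).
  elim: r => [|w r IHr]; first by rewrite !big_nil det1.
  rewrite !big_cons -mulmxE det_mulmx IHr; congr (_ * _).
  rewrite rmorphB /= horner_mx_X horner_mx_C -opprB -scaleN1r detZ det_sub.
  rewrite exp_d -big_split /=.
  by apply: eq_bigr => z _; rewrite mulN1r opprB.
rewrite exchange_big /= exp_d -big_split /=; apply: eq_bigr => z _.
rewrite hornerZ horner_prod; congr (_ * _).
by apply: eq_bigr => w _; rewrite !hornerE.
Qed.

(** [horner_mx] asks for a size of the form [d.+1], which the size of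
    [companionmx p] only is after a case analysis. *)
Lemma companion_exists (R : comNzRingType) (p : {poly R}) : p \is monic ->
  (1 < size p)%N -> exists d, exists A : 'M[R]_d.+1, char_poly A = p.
Proof.
move=> /companionmxK; move: (companionmx p).
by case: (size p) => [|[|d]] // A <- _; exists d, A.
Qed.

(** The product is the determinant of the integer matrix [P(A)], where [A] is
    the companion matrix of [p]. *)
Lemma prod_horner_roots_int (K : numClosedFieldType) (p P : {poly int})
    (s : seq K) : p \is monic -> (1 < size p)%N ->
  map_poly intr p = \prod_(z <- s) ('X - z%:P) ->
  exists m : int, \prod_(z <- s) (map_poly intr P).[z] = m%:~R.
Proof.
move=> mp sp ps; have [d [A Ap]] := companion_exists mp sp.
exists (\det (horner_mx A P)).
rewrite -(@det_horner_mx _ _ (map_mx intr A)).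
  by rewrite -map_horner_mx det_map_mx.
by rewrite -map_char_poly Ap.
Qed.

(** The lowest nonzero coefficient of [p * q] is [p`_0] times that of [q], hence
    even, whereas that of [P] is 1 or -1. *)
Lemma ndvdp_unit_coefs (p P : {poly int}) : p`_0 != 0 -> (2%Z %| p`_0)%Z ->
  P != 0 -> (forall i, `|P`_i| <= 1) -> ~ exists q, P = p * q.
Proof.
move=> p0 p2 P0 P1 [q Pq]; have q0 : q != 0.
  by apply: contraNneq P0 => q0; rewrite Pq q0 mulr0.
have ex_q : exists i, q`_i != 0 by exists (size q).-1; rewrite -lead_coefE lead_coef_eq0.
have [j qj jmin] := ex_minnP ex_q.
have Pj : P`_j = p`_0 * q`_j.
  rewrite Pq coefM big_ord_recl /= subn0 big1 ?addr0 // => i _.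
  case: (eqVneq q`_(j - bump 0 i) 0) => [->|/jmin]; first by rewrite mulr0.
  by rewrite /bump leq0n add1n leqNgt ltn_subrL /= (leq_ltn_trans _ (ltn_ord i)).
have := P1 j; rewrite Pj.
have : (2%Z %| p`_0 * q`_j)%Z by rewrite dvdz_mulr.
have : p`_0 * q`_j != 0 by rewrite mulf_neq0.
case/dvdzP: p2 => c ->; move: (c * 2%Z * q`_j) => x x0 /dvdzP[y xy].
move: x0; rewrite {}xy mulf_eq0 negb_or => /andP[y0 _].
by apply/negP; rewrite normrM -ltNge; case: y y0 => [[|y]|y].
Qed.

(** A geometric series. *)
Lemma horner_norm_le (K : numFieldType) (P : {poly int}) (n : nat) (z : K) :
  (forall i, `|P`_i| <= 1) -> (size P <= n)%N -> 1 < `|z| ->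
  `|(map_poly intr P).[z]| * (`|z| - 1) <= `|z| ^+ n.
Proof.
move=> P1 Pn z1; apply: (@le_trans _ _ ((\sum_(i < n) `|z| ^+ i) * (`|z| - 1))).
  rewrite ler_wpM2r ?subr_ge0 ?(ltW z1) //.
  rewrite (@horner_coef_wide _ n) ?(leq_trans (size_poly _ _)) //.
  apply: le_trans (ler_norm_sum _ _ _) _; apply: ler_sum => i _.
  rewrite normrM normrX coef_map /= ler_piMl ?exprn_ge0 //.
  by rewrite -intr_norm -[1]/(1%:~R) ler_int.
by rewrite mulrC -subrX1 gerBl.
Qed.

Lemma irreducible_dvdp_root (F L : fieldType) (f : {rmorphism F -> L})
    (p q : {poly F}) (x : L) : irreducible_poly p ->
  root (map_poly f p) x -> root (map_poly f q) x -> p %| q.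
Proof.
move=> ip px /rootP qx; move: (irreducible_poly_coprime q ip).
case: (_ %| _) => //; rewrite -(coprimep_map f) => cpq.
by have := coprimep_root cpq px; rewrite qx eqxx.
Qed.

Lemma map_ratr_intr (L : numFieldType) (p : {poly int}) :
  map_poly ratr (map_poly intr p : {poly rat}) = map_poly intr p :> {poly L}.
Proof. by rewrite -map_poly_comp; apply: eq_map_poly => x /=; rewrite ratr_int. Qed.

(** The product of [|P(z)|] over the conjugates is a nonzero integer, so at
    least 1; bounding the factors with [z <> b] by [horner_norm_le] leaves a
    lower bound for [|P(b)|], since [|b|] times the other [|z|] is 2. *)
Lemma conjugate_separation (K : numClosedFieldType) (p P : {poly int})
    (s : seq K) (b : K) (n : nat) : p \is monic ->
  irreducible_poly (map_poly intr p : {poly rat}) ->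
  map_poly intr p = \prod_(z <- s) ('X - z%:P) ->
  \prod_(z <- s) z = 2 \/ \prod_(z <- s) z = - 2 ->
  (forall z, z \in s -> 1 < `|z|) -> b \in s ->
  P != 0 -> (size P <= n)%N -> (forall i, `|P`_i| <= 1) ->
  \prod_(z <- rem b s) (`|z| - 1) * `|b| ^+ n <=
    2 ^+ n * `|(map_poly intr P).[b]|.
Proof.
move=> mp ip ps s2 s1 bs P0 Pn P1.
have sp : (1 < size p)%N by case: ip; rewrite size_rat_int_poly.
have prods : \prod_(z <- s) `|z| = 2.
  by rewrite -normr_prod; case: s2 => ->; rewrite ?normrN normr_nat.
have p0 : `|p`_0| = 2.
  apply: (@intr_inj K); rewrite intr_norm -coef_map /= ps -horner_coef0 -[RHS]/(2 : K).
  rewrite horner_prod normr_prod -prods; apply: eq_bigr => z _.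
  by rewrite !hornerE normrN.
have root_neq0 z : z \in s -> (map_poly intr P).[z] != 0 :> K.
  move=> zs; apply/negP => /eqP Pz.
  have pP : (map_poly intr p : {poly rat}) %| map_poly intr P.
    apply: (irreducible_dvdp_root (f := ratr : {rmorphism rat -> K}) (x := z) ip).
      by rewrite map_ratr_intr ps root_prod_XsubC.
    by rewrite map_ratr_intr; apply/rootP.
  have [p1 [a a0 pa] [q Pq]] := dvdpP_rat_int pP.
  (* Since [p] is monic, the integer divisor [p1] of [P] is an integer multiple of [p]. *)
  have pE : p1 = lead_coef p1 *: p.
    apply: (@map_inj_poly _ _ (intr : int -> rat)) => //; first exact: intr_inj.
    rewrite linearZ /= pa scalerA; suff -> : (lead_coef p1)%:~R * a = 1 by rewrite scale1r.
    have /(congr1 lead_coef) := pa; rewrite lead_coefZ !lead_coef_map_inj //;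
      try exact: intr_inj.
    by rewrite (monicP mp) mulrC => <-.
  apply: (@ndvdp_unit_coefs p P) => //.
  - by rewrite -normr_eq0 p0.
  - by move: p0; rewrite -abszE dvdzE => -[->].
  - by exists (lead_coef p1 *: q); rewrite -scalerAr scalerAl -pE.
have prod1 : 1 <= \prod_(z <- s) `|(map_poly intr P).[z]|.
  have [m Pm] := prod_horner_roots_int P mp sp ps.
  rewrite -normr_prod Pm -intr_norm -[1]/(1%:~R) ler_int -gtz0_ge1 normr_gt0.
  apply/eqP => m0; move: Pm; rewrite m0 => /eqP; rewrite prodf_seq_eq0.
  by move=> /hasP[z zs] /=; apply/negP/root_neq0.
set r := rem b s; have rs z : z \in r -> z \in s by exact: mem_rem.
have perm_s := perm_to_rem bs.
move: prod1 prods; rewrite !(perm_big _ perm_s) /= !big_cons => prod1 prods.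
have r_ge0 : 0 <= \prod_(z <- r) (`|z| - 1).
  by rewrite big_seq prodr_ge0 // => z /rs /s1 z1; rewrite subr_ge0 ltW.
rewrite -prods exprMn mulrC -mulrA ler_wpM2l ?exprn_ge0 // mulrC.
apply: le_trans (ler_peMl r_ge0 prod1) _; rewrite -mulrA ler_wpM2l //.
rewrite -big_split /= -prodrXl big_seq [leRHS]big_seq; apply: ler_prod => z /rs zs.
by rewrite horner_norm_le ?s1 // mulr_ge0 // subr_ge0 ltW ?s1.
Qed.

(** * Separation of digit sums in a Garsia base *)

(** Gauss's lemma: [p] divides over the rationals a monic integer polynomial,
    hence is proportional to an integer divisor of it, whose leading coefficient
    is then 1 or -1. *)
Lemma min_poly_integral (L : numFieldType) (x : L) (p : {poly rat}) :
  p \is monic -> irreducible_poly p -> root (map_poly ratr p) x ->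
  integralOver (intr : int -> L) x ->
  exists2 p0 : {poly int}, p0 \is monic & p = map_poly intr p0.
Proof.
move=> mp ip px [q mq qx].
have pq : p %| map_poly intr q.
  by apply: irreducible_dvdp_root ip px _; rewrite map_ratr_intr.
have [p1 [a a0 pE] [r qE]] := dvdpP_rat_int pq.
have l1 : lead_coef p1 * lead_coef p1 = 1.
  have : lead_coef p1 * lead_coef r = 1 by rewrite -lead_coefM -qE (monicP mq).
  rewrite mulrC => /intUnitRing.unitzPl; rewrite qualifE /=.
  by move=> /orP[] /eqP ->.
exists (lead_coef p1 *: p1); first by rewrite monicE lead_coefZ l1.
rewrite linearZ /= {1}pE; congr (_ *: _).
have := congr1 lead_coef pE; rewrite lead_coefZ lead_coef_map_inj //; last exact: intr_inj.
rewrite (monicP mp) => aE.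
by rewrite -[LHS]mulr1 -[in LHS](rmorph1 (intr : int -> rat)) -l1 rmorphM mulrA -aE mul1r.
Qed.

(** The constant is the product of [|z| - 1] over the conjugates [z] other than
    [beta]. *)
Lemma garsia_separation (R : realType) (beta : R) : garsia_number beta ->
  exists2 C : R, 0 < C & forall n (e e' : {ffun 'I_n -> bool}), e != e' ->
    C / 2 ^+ n <= `|digit_sum beta e - digit_sum beta e'|.
Proof.
move=> [b0 bint [s [[p [mp ip pb] ps] s2 s1]]].
have [p0 mp0 pE] := min_poly_integral mp ip pb bint.
have bs : beta%:C%C \in s.
  rewrite -root_prod_XsubC -ps.
  have -> : map_poly ratr p = map_poly (real_complex R) (map_poly ratr p).
    by rewrite -map_poly_comp; apply: eq_map_poly => x /=; rewrite fmorph_rat.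
  by rewrite fmorph_root.
pose D : R[i] := \prod_(z <- rem beta%:C%C s) (`|z| - 1).
have D0 : 0 < D.
  rewrite /D big_seq prodr_gt0 // => z /mem_rem zs.
  by rewrite subr_gt0 s1.
have DE : (complex.Re D)%:C%C = D by rewrite RRe_real // gtr0_real.
exists (complex.Re D); first by rewrite -ltcR DE.
move=> n e e' ee'; pose d i : int := (e i)%:Z - (e' i)%:Z.
(* The coefficient of degree [j] is the digit difference of index [n - 1 - j]. *)
pose P := \poly_(j < n) (if insub j is Some i then d (rev_ord i) else 0).
have PE (i : 'I_n) : P`_i = d (rev_ord i) by rewrite coef_poly ltn_ord valK.
have P0 : P != 0.
  apply: contra_neq ee' => PE0; apply/ffunP => i.
  have := PE (rev_ord i); rewrite PE0 coef0 rev_ordK /d.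
  by case: (e i); case: (e' i).
have P1 i : `|P`_i| <= 1.
  have [ni|ni] := leqP n i; first by rewrite nth_default // (leq_trans (size_poly _ _)).
  by rewrite (PE (Ordinal ni)) /d; case: (e _); case: (e' _).
have Pb : (map_poly intr P).[beta] = beta ^+ n * (digit_sum beta e - digit_sum beta e').
  rewrite (@horner_coef_wide _ n); last first.
    by rewrite (leq_trans (size_poly _ _)) // size_poly.
  rewrite (reindex_inj rev_ord_inj) /= /digit_sum -sumrB mulr_sumr.
  apply: eq_bigr => i _; rewrite -mulrBl coef_map (PE (rev_ord i)) rev_ordK /= rmorphB /=.
  rewrite mulrCA; congr (_ * _).
  by rewrite exprB ?unitfE ?gt_eqF.
have := @conjugate_separation R[i] p0 P s beta%:C%C n mp0.
rewrite -pE -ps -map_ratr_intr -pE => /(_ ip erefl s2 s1 bs P0 (size_poly _ _) P1).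
rewrite -/D -DE.
have -> : map_poly intr P = map_poly (real_complex R) (map_poly intr P).
  by rewrite -map_poly_comp; apply: eq_map_poly => x /=; rewrite rmorph_int.
rewrite horner_map Pb normc_def /= expr0n addr0 sqrtr_sqr.
rewrite normc_def /= expr0n addr0 sqrtr_sqr.
have -> : 2 ^+ n = (2 ^+ n)%:C%C :> R[i] by rewrite rmorphXn rmorph_nat.
rewrite -!(rmorphXn (real_complex R)) -!rmorphM lecR.
rewrite (gtr0_norm b0) normrM normrX (gtr0_norm b0) mulrCA mulrC.
rewrite ler_pM2l ?exprn_gt0 // ler_pdivrMr ?exprn_gt0 ?ltr0n //.
by rewrite [X in _ -> _ <= X]mulrC.
Qed.

(** * Unions of intervals with separated left endpoints *)

Section intervals.
Context {R : realType}.
Implicit Types (L : seq (R * R)) (s : seq R).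
Local Notation mu := (@lebesgue_measure R).

Definition intervals L : set R :=
  \big[setU/set0]_(p <- L) `[p.1, p.1 + p.2]%classic.

Lemma mem_intervals L t : intervals L t <->
  exists2 p, p \in L & p.1 <= t <= p.1 + p.2.
Proof.
rewrite /intervals -bigcup_seq; split=> [[p pL]|[p pL pt]].
  by rewrite /= in_itv; exists p.
by exists p => //=; rewrite in_itv.
Qed.

Lemma measurable_intervals L : measurable (intervals L).
Proof. by apply: bigsetU_measurable => p _; exact: measurable_itv. Qed.

Definition spaced (d : R) s := pairwise (fun x y => d <= `|x - y|) s.

Lemma mu_closed_interval (x l : R) : 0 <= l ->
  (mu `[x, (x + l)]%classic = l%:E).
Proof.
move=> l0; rewrite lebesgue_measure_itv /= lte_fin ltrDl.
case: ltgtP l0 => // [_ _|<- //]; by rewrite -EFinD addrC addKr.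
Qed.

(** The intervals are disjoint since they are shorter than the gaps. *)
Lemma measure_setU_spaced (V : set R) (d l : R) s :
  measurable V -> 0 <= l < d -> spaced d s ->
  (forall x, x \in s -> V `&` `[x, x + l]%classic = set0) ->
  (mu (V `|` intervals [seq (x, l) | x <- s]) = mu V + ((size s)%:R * l)%:E)%E.
Proof.
move=> mV /andP[l0 ld]; elim: s V mV => [|x s IHs] V mV.
  by rewrite /intervals big_nil setU0 mul0r adde0.
rewrite /spaced pairwise_cons => /andP[/allP xs ss] Vs.
rewrite /intervals /= big_cons -/(intervals _) setUA IHs //.
- have mVx : (mu (V `|` `[x, (x + l)%R]%classic) = mu V + mu `[x, (x + l)%R]%classic)%E.
    by apply: measureU => //; exact/Vs/mem_head.
  rewrite mVx.
  rewrite -/mu mu_closed_interval // -addeA -EFinD; congr (_ + _%:E)%E.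
  by rewrite -addn1 natrD mulrDl mul1r addrC.
- exact: measurableU.
- move=> y ys; rewrite setIUl Vs ?in_cons ?ys ?orbT // set0U.
  apply/seteqP; split=> // t /= []; rewrite !in_itv /= => /andP[t1 t2] /andP[t3 t4].
  have := xs y ys; apply/negP; rewrite -ltNge; apply: le_lt_trans ld.
  rewrite ler_norml; lra.
Qed.

(** Points that are [d] apart carry disjoint intervals of length [d / 2], which
    all lie in [[u, v + d / 2]]. *)
Lemma spaced_size_le (u v d : R) s : 0 < d -> u <= v -> spaced d s ->
  (forall x, x \in s -> u <= x <= v) -> (size s)%:R <= 1 + 2 * (v - u) / d.
Proof.
move=> d0 uv sep suv.
have d2 : 0 <= d / 2 < d by lra.
have := measure_setU_spaced measurable0 d2 sep.
rewrite set0U measure0 add0e => h.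
have {h} : mu (intervals [seq (x, d / 2) | x <- s]) = ((size s)%:R * (d / 2))%:E.
  by apply: h => x _; rewrite set0I.
move=> h; have : (((size s)%:R * (d / 2))%:E <= (v - u + d / 2)%:E)%E.
  rewrite -h; have -> : ((v - u + d / 2)%:E = mu `[u, (u + (v - u + d / 2))%R]%classic)%E.
    by rewrite mu_closed_interval //; lra.
  rewrite le_measure ?inE //; first exact: measurable_intervals.
  move=> t /mem_intervals[_ /mapP[x xs ->] /=] /andP[t1 t2].
  by have := suv x xs; rewrite in_itv /=; lra.
rewrite lee_fin => {}h.
rewrite -(ler_pM2r (_ : 0 < d / 2)); last by lra.
by rewrite (_ : (1 + _) * (d / 2) = v - u + d / 2) //; field; rewrite ?gt_eqF.
Qed.

Lemma count_has_le (T U : eqType) (r : T -> U -> bool) (s : seq T) (L : seq U) :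
  (count (fun x => has (r x) L) s <= \sum_(p <- L) count (r^~ p) s)%N.
Proof.
elim: L => [|p L IHL]; first by rewrite big_nil; elim: s.
rewrite big_cons; apply: leq_trans (leq_add (leqnn _) IHL).
rewrite -(count_predUI (r^~ p)) /= leq_addr //.
Qed.

(** The measure grows at least by the intervals [[x, x + l]] that miss all those
    of [L]; by [spaced_size_le] the interval of [p] is met by at most
    [2 + 2 * p.2 / d] of them. *)
Lemma measure_add_level L s (d l : R) : 0 < d -> 0 <= l <= d / 2 ->
  (forall p, p \in L -> 0 <= p.2) -> spaced d s ->
  (mu (intervals L) +
     (l * ((size s)%:R - \sum_(p <- L) (2 + 2 * p.2 / d)))%:E
   <= mu (intervals (L ++ [seq (x, l) | x <- s])))%E.
Proof.
move=> d0 /andP[l0 ld] L0 sep.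
pose meets (x : R) (p : R * R) := (x <= p.1 + p.2) && (p.1 <= x + l).
pose G := [seq x <- s | ~~ has (meets x) L].
have sepG : spaced d G.
  exact: pairwise_filter.
have sizeG : (size s)%:R - \sum_(p <- L) (2 + 2 * p.2 / d) <= (size G)%:R.
  rewrite lerBlDr size_filter -(count_predC (fun x => has (meets x) L)) natrD.
  rewrite addrC lerD2l.
  apply: (@le_trans _ _ (\sum_(p <- L) count (meets^~ p) s)%:R).
    by rewrite ler_nat count_has_le.
  rewrite natr_sum big_seq [leRHS]big_seq; apply: ler_sum => p pL.
  rewrite -size_filter; have p0 := L0 p pL.
  have h := @spaced_size_le (p.1 - l) (p.1 + p.2) d [seq x <- s | meets x p].
  apply: le_trans (h _ _ _ _) _ => //; first lra.
  - exact: pairwise_filter.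
  - by move=> x; rewrite mem_filter /meets => /andP[/andP[x1 x2] _]; lra.
  rewrite (_ : 2 * _ / d = 2 * p.2 / d + 2 * (l / d)); last by field; rewrite ?gt_eqF.
  have : l / d <= 1 / 2 by rewrite ler_pdivrMr //; lra.
  lra.
have disj x : x \in G -> intervals L `&` `[x, x + l]%classic = set0.
  rewrite mem_filter => /andP[/hasPn xL _].
  apply/seteqP; split=> // t [] /mem_intervals[p pL pt]; rewrite /= in_itv /= => xt.
  by have := xL p pL; rewrite /meets => /negP; apply; lra.
have ld' : 0 <= l < d by lra.
have := measure_setU_spaced (measurable_intervals L) ld' sepG disj.
move=> mG; apply: (@le_trans _ _ (mu (intervals L `|` intervals [seq (x, l) | x <- G]))).
  by rewrite mG leeD2l // lee_fin mulrC ler_wpM2r.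
rewrite le_measure ?inE //; last 1 first.
- move=> t [] /mem_intervals[p pL pt]; apply/mem_intervals; exists p => //.
    by rewrite mem_cat pL.
  rewrite mem_cat; apply/orP; right; move: pL => /mapP[x + ->].
  by rewrite mem_filter => /andP[_ xs]; exact: map_f.
- by apply: measurableU; exact: measurable_intervals.
- exact: measurable_intervals.
Qed.

End intervals.

(** * Limsup sets of evenly spread intervals *)

Section levels.
Context {R : realType}.
Local Notation mu := (@lebesgue_measure R).
Variables (X : nat -> seq R) (psi : nat -> R) (b : R).
Hypothesis b0 : 0 < b.
Hypothesis sizeX : forall n, size (X n) = (2 ^ n)%N.
Hypothesis sepX : forall n, spaced (b / 2 ^+ n) (X n).
Hypothesis psi_bnd : forall n, 0 <= psi n <= b / 2 ^+ n / 2.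

Definition level n : seq (R * R) := [seq (x, psi n) | x <- X n].

Fixpoint levels (Q : pred nat) (N : nat) : seq (R * R) :=
  if N is n.+1 then levels Q n ++ (if Q n then level n else [::]) else [::].

Lemma mem_levels Q N p : p \in levels Q N ->
  exists n, [/\ (n < N)%N, Q n & p \in level n].
Proof.
elim: N => //= N IHN; rewrite mem_cat => /orP[/IHN[n [nN Qn pn]]|].
  by exists n; split=> //; rewrite ltnS ltnW.
by case: ifP => // QN pN; exists N.
Qed.

Lemma sum_levels Q N (F : R -> R) :
  \sum_(p <- levels Q N) F p.2 =
  \sum_(n < N) (if Q n then 2 ^+ n * F (psi n) else 0).
Proof.
elim: N => [|N IHN]; first by rewrite big_nil big_ord0.
rewrite big_cat big_ord_recr /= IHN; congr (_ + _); case: ifP; rewrite ?big_nil //.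
move=> _; rewrite big_map /= big_const_seq count_predT iter_addr_0 sizeX.
by rewrite -[LHS]mulr_natl natrX.
Qed.

(** The case distinction makes the induction work: a level that follows a
    used one is skipped.  The bound [2 ^ N / 3] at a used level [N] is
    what leaves room for fresh intervals at that level. *)
Lemma sum_exp2_sparse (Q : pred nat) N : (forall n, Q n -> ~~ Q n.+1) ->
  3 * (\sum_(n < N) (if Q n then 2 ^+ n else 0)) <=
  (if Q N then 2 ^+ N else 2 ^+ N.+1) :> R.
Proof.
move=> Qsparse; elim: N => [|N IHN].
  by rewrite big_ord0 mulr0; case: ifP; rewrite exprn_ge0.
have N0 : 0 <= 2 ^+ N :> R by rewrite exprn_ge0.
rewrite big_ord_recr /= mulrDr; move: IHN; have := Qsparse N.
case: (Q N) => [/(_ isT)/negPf -> IHN|_ IHN]; first by rewrite !exprS in IHN *; lra.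
by case: ifP; rewrite !exprS in IHN *; lra.
Qed.

Local Notation S Q N := (\sum_(n < N) (if Q n then 2 ^+ n * psi n else 0)).

(** At a used level [N], at most [2 * 2 ^ N / 3] intervals are lost to endpoint
    effects and at most [2 ^ N / 6] to the lengths of the earlier intervals, so
    that at least [2 ^ N / 6] of them are new. *)
Lemma measure_levels_step (Q : pred nat) N : (forall n, Q n -> ~~ Q n.+1) ->
  S Q N <= b / 12 -> ((S Q N / 6)%:E <= mu (intervals (levels Q N)))%E ->
  ((S Q N.+1 / 6)%:E <= mu (intervals (levels Q N.+1)))%E.
Proof.
move=> Qsparse SN muN; rewrite big_ord_recr /=; case: ifPn => QN; last first.
  by rewrite addr0 cats0.
have p2N : 0 < 2 ^+ N :> R by rewrite exprn_gt0.
have d0 : 0 < b / 2 ^+ N by rewrite divr_gt0.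
have L0 p : p \in levels Q N -> 0 <= p.2.
  move=> /mem_levels[n [_ _ /mapP[x _ ->]]] /=.
  by have /andP[] := psi_bnd n.
apply: le_trans (measure_add_level d0 (psi_bnd N) L0 (@sepX N)).
rewrite mulrDl EFinD; apply: leeD => //; rewrite lee_fin.
have /andP[psi0 _] := psi_bnd N.
rewrite (mulrC (2 ^+ N)) -mulrA ler_wpM2l // sizeX natrX.
rewrite (@sum_levels Q N (fun l => 2 + 2 * l / (b / 2 ^+ N))).
have -> : \sum_(n < N) (if Q n then 2 ^+ n * (2 + 2 * psi n / (b / 2 ^+ N)) else 0) =
    2 * (\sum_(n < N) (if Q n then 2 ^+ n else 0)) + 2 * 2 ^+ N / b * S Q N.
  rewrite !mulr_sumr -big_split /=; apply: eq_bigr => n _.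
  case: (Q n); last by rewrite !mulr0 addr0.
  by field; rewrite gt_eqF //= expf_neq0.
have := sum_exp2_sparse N Qsparse; rewrite QN.
have : 2 * 2 ^+ N / b * S Q N <= 2 ^+ N / 6.
  have c0 : 0 <= 2 * 2 ^+ N / b by rewrite divr_ge0 ?mulr_ge0 // ltW.
  have -> : 2 ^+ N / 6 = 2 * 2 ^+ N / b * (b / 12) by field; rewrite gt_eqF.
  exact: ler_wpM2l SN.
lra.
Qed.

(** [measure_levels_step] is applied up to the first [N] at which the total
    length exceeds [b / 12]; then [b / 12 / 6] has been gained. *)
Lemma measure_levels_ge (Q : pred nat) N : (forall n, Q n -> ~~ Q n.+1) ->
  b / 12 < S Q N -> exists N', ((b / 72)%:E <= mu (intervals (levels Q N')))%E.
Proof.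
move=> Qsparse SN.
have ex : exists N, b / 12 < S Q N by exists N.
have [[|N'] N1 Nmin] := ex_minnP ex.
  by move: N1; rewrite big_ord0 ltNge divr_ge0 // ltW.
have SN' k : (k <= N')%N -> S Q k <= b / 12.
  by move=> kN; rewrite leNgt; apply/negP => /Nmin; rewrite leqNgt ltnS kN.
have muN k : (k <= N')%N -> ((S Q k / 6)%:E <= mu (intervals (levels Q k)))%E.
  elim: k => [_|k IHk kN]; first by rewrite big_ord0 mul0r.
  by apply: measure_levels_step; rewrite ?SN' ?IHk // ltnW.
have step := measure_levels_step Qsparse (SN' N' (leqnn _)) (muN _ (leqnn _)).
exists N'.+1; apply: le_trans step.
rewrite lee_fin; lra.
Qed.

Hypothesis divergent : forall M A, exists N, A <= \sum_(M <= n < N) 2 ^+ n * psi n.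

Definition tail M : set R := \bigcup_(n in [set n | (M <= n)%N]) intervals (level n).

(** The levels of one of the two parities already have total length greater than
    [b / 12]. *)
Lemma measure_tail_ge M : ((b / 72)%:E <= mu (tail M))%E.
Proof.
pose Q c n := (M <= n)%N && (odd n == c).
have Qsparse c n : Q c n -> ~~ Q c n.+1.
  rewrite /Q => /andP[_ /eqP <-]; rewrite negb_and /=.
  by case: (odd n); rewrite orbT.
have [N SN] := divergent M (b / 4).
pose s c : R := S (Q c) N.
have [c ScN] : exists c, b / 12 < s c.
  have sE : \sum_(M <= n < N) 2 ^+ n * psi n = s true + s false.
    rewrite big_geq_mkord big_mkcond /= -big_split /=; apply: eq_bigr => n _.
    rewrite /Q; case: (M <= n)%N; case: (odd n); by rewrite /= ?addr0 ?add0r.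
  rewrite sE in SN; have [h|h] := ltP (b / 12) (s true); first by exists true.
  by exists false; move: b0; lra.
have [N' h] := measure_levels_ge (Qsparse c) ScN.
apply: le_trans h _; apply: le_measure; rewrite ?inE.
- exact: measurable_intervals.
- by apply: bigcup_measurable => n _; exact: measurable_intervals.
move=> t /mem_intervals[p /mem_levels[n [_ /andP[Mn _] pn]] pt].
by exists n => //; apply/mem_intervals; exists p.
Qed.

(** Continuity from above; boundedness makes the measure of the tails finite. *)
Lemma measure_limsup_ge (u v : R) :
  (forall n x, x \in X n -> u <= x /\ x + psi n <= v) ->
  ((b / 72)%:E <= mu (\bigcap_M tail M))%E.
Proof.
move=> Xuv.
have mtail M : measurable (tail M).
  by apply: bigcup_measurable => n _; exact: measurable_intervals.
have h := @nonincreasing_cvg_mu _ _ _ mu tail.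
have : (mu \o tail) M @[M --> \oo] --> mu (\bigcap_M tail M).
  apply: h => //.
  - apply: (@le_lt_trans _ _ (mu `[u, v]%classic)).
      apply: le_measure; rewrite ?inE; [exact: mtail|exact: measurable_itv|].
      move=> t [n _ /mem_intervals[_ /mapP[x xX ->] /=]].
      by rewrite in_itv /=; have := Xuv n x xX; lra.
    by rewrite lebesgue_measure_itv /=; case: ifP => _; rewrite ?ltry.
  - exact: bigcapT_measurable.
  - move=> m n mn; apply/subsetPset => t [k nk tk]; exists k => //=.
    exact: leq_trans nk.
move=> /cvge_to_ge; apply; near=> M; exact: measure_tail_ge.
Unshelve. all: by end_near. Qed.

End levels.

(** * Digit words and cylinders *)

Section words.
Context {R : realType}.
Variable beta : R.
Hypothesis beta_gt1 : 1 < beta.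

Let beta_gt0 : 0 < beta. Proof. exact: lt_trans beta_gt1. Qed.

Definition cat_word k n (e : {ffun 'I_k -> bool}) (f : {ffun 'I_n -> bool}) :
    {ffun 'I_(k + n) -> bool} :=
  [ffun i => match fintype.split i with inl a => e a | inr c => f c end].

Lemma digit_sum_cat k n (e : {ffun 'I_k -> bool}) (f : {ffun 'I_n -> bool}) :
  digit_sum beta (cat_word e f) = digit_sum beta e + digit_sum beta f / beta ^+ k.
Proof.
rewrite /digit_sum big_split_ord /=; congr (_ + _).
  by apply: eq_bigr => i _; rewrite ffunE (unsplitK (inl _ i)).
rewrite mulr_suml; apply: eq_bigr => i _; rewrite ffunE (unsplitK (inr _ i)).
by rewrite -addnS exprD invfM mulrA mulrAC.
Qed.

Lemma digit_sum_bounds n (e : {ffun 'I_n -> bool}) :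
  0 <= digit_sum beta e <= (beta - 1)^-1.
Proof.
apply/andP; split; first by apply: sumr_ge0 => i _; rewrite divr_ge0 ?exprn_ge0 // ltW.
apply: (@le_trans _ _ (\sum_(i < n) (beta ^+ i.+1)^-1)).
  apply: ler_sum => i _; rewrite ler_pdivrMr ?exprn_gt0 // mulVf ?expf_neq0 ?gt_eqF //.
  by case: (e i).
have -> : \sum_(i < n) (beta ^+ i.+1)^-1 = (1 - (beta ^+ n)^-1) / (beta - 1).
  elim: n {e} => [|n IHn]; first by rewrite big_ord0 expr0 invr1 subrr mul0r.
  rewrite big_ord_recr IHn /= exprS; field.
  by rewrite subr_eq0 !gt_eqF ?exprn_gt0.
rewrite ler_pdivrMr ?subr_gt0 // mulVf ?subr_eq0 ?gt_eqF //.
by rewrite gerBl invr_ge0 exprn_ge0 // ltW.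
Qed.

(** The greedy expansion: the map sending [x] to [beta * x - d], with [d = 1]
    exactly when [beta * x >= 1], preserves [[0, (beta - 1)^-1]] because
    [beta <= 2]. *)
Lemma digit_sum_dense (beta_le2 : beta <= 2) k (x : R) :
  0 <= x <= (beta - 1)^-1 -> exists e : {ffun 'I_k -> bool},
    0 <= x - digit_sum beta e <= (beta - 1)^-1 / beta ^+ k.
Proof.
have inv1 : 1 <= (beta - 1)^-1 by rewrite invf_ge1 ?subr_gt0 //; lra.
elim: k x => [|k IHk] x x01.
  by exists [ffun=> false]; rewrite /digit_sum big_ord0 expr0 divr1 subr0.
pose d : bool := 1 <= beta * x.
have : 0 <= beta * x - d%:R <= (beta - 1)^-1.
  have bx : beta * x <= 1 + (beta - 1)^-1.
    rewrite (_ : 1 + _ = beta * (beta - 1)^-1) ?ler_pM2l //; first by case/andP: x01.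
    by field; rewrite subr_eq0 gt_eqF.
  have bx0 : 0 <= beta * x by case/andP: x01 => x0 _; rewrite mulr_ge0 // ltW.
  by rewrite /d; case: (leP 1 (beta * x)) => bx1 /=; lra.
move=> /IHk[e /andP[e0 e1]].
(* Prepending a digit keeps the length [1 + k] convertible to [k.+1]. *)
exists (@cat_word 1 k [ffun=> d] e).
rewrite -[digit_sum _ _]/(@digit_sum _ beta (1 + k) (@cat_word 1 k [ffun=> d] e)).
rewrite digit_sum_cat.
have -> : digit_sum beta ([ffun=> d] : {ffun 'I_1 -> bool}) = d%:R / beta :> R.
  by rewrite /digit_sum big_ord1 ffunE.
have -> : x - (d%:R / beta + digit_sum beta e / beta ^+ 1) =
          (beta * x - d%:R - digit_sum beta e) / beta by field; rewrite gt_eqF.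
rewrite divr_ge0 ?(ltW beta_gt0) //= exprSr invfM mulrA ler_pM2r ?invr_gt0 //.
Qed.

End words.

(** * Truncated divergent series and density points *)

(** If the truncated sums were bounded, their terms would tend to 0, so that
    eventually the truncation would change nothing and the sum of [a] would be
    finite. *)
Lemma truncated_sum_divergent (R : realType) (a : nat -> R) (c : R) :
  0 < c -> (forall n, (1 <= n)%N -> 0 <= a n) ->
  (\sum_(1 <= n <oo) (a n)%:E = +oo)%E ->
  forall M A, (1 <= M)%N -> exists N, A <= \sum_(M <= n < N) Num.min (a n) c.
Proof.
move=> c0 a0 aoo M A M1; apply: contrapT => nN.
have sumA N : \sum_(M <= n < N) Num.min (a n) c <= A.
  by rewrite leNgt; apply/negP => /ltW AN; apply: nN; exists N.
pose v n := if (M <= n)%N then Num.min (a n) c else 0.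
have v0 n : 0 <= v n.
  rewrite /v; case: ifP => // Mn; rewrite le_min (ltW c0) a0 //.
  exact: leq_trans Mn.
have vsum N : series v N = \sum_(M <= n < N) Num.min (a n) c.
  by rewrite /series /= big_mkord big_geq_mkord [RHS]big_mkcond.
have /cvg_series_cvg_0 : cvgn (series v).
  apply: nondecreasing_is_cvgn.
    by apply: nondecreasing_series => n _ _.
  by exists A => _ [N _ <-]; rewrite vsum.
move=> /cvgr0_norm_lt/(_ c c0)[N0 _ vc].
have av n : (maxn M N0 <= n)%N -> a n = v n.
  rewrite geq_max => /andP[Mn Nn]; have := vc n Nn; rewrite /= ger0_norm // /v Mn.
  by rewrite /Num.min; case: ifP => //; rewrite ltxx.
set N1 := maxn M N0 in av.
suff : (\sum_(1 <= n <oo) (a n)%:E <= (\sum_(1 <= n < N1) a n + A)%:E)%E by rewrite aoo.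
apply: lime_le.
  by apply: is_cvg_nneseries => n n1 _; rewrite lee_fin a0.
near=> N; rewrite sumEFin lee_fin.
have N1N : (N1 <= N)%N by near: N; exact: nbhs_infty_ge.
rewrite (@big_cat_nat _ _ _ N1) //=; last by rewrite leq_max M1.
rewrite lerD2l; apply: le_trans (sumA N); rewrite -vsum /series /=.
rewrite (@big_cat_nat _ _ _ N1 0) //= ler_wpDl ?sumr_ge0 //.
rewrite le_eqVlt; apply/orP; left; apply/eqP; apply: eq_big_nat => n /andP[n1 _].
exact: av.
Unshelve. all: by end_near. Qed.

Section density.
Context {R : realType}.
Local Notation mu := (@lebesgue_measure R).

(** No point of [A] is a density point of [A]. *)
Lemma ae_notin_of_local_gap (A : set R) (eta : R) (r : nat -> R) :
  measurable A -> 0 < eta -> (forall k, 0 < r k) -> r @ \oo --> 0 ->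
  (forall x k, A x ->
     (mu (A `&` ball x (r k)) <= ((1 - eta) * (r k *+ 2))%:E)%E) ->
  {ae mu, forall x, ~ A x}.
Proof.
move=> mA eta0 r0 rcvg gap.
have ae_filter := ae_filter_ringOfSetsType mu.
have := lebesgue_density mA; apply: filterS => x dens Ax.
rewrite indicE mem_set // in dens.
have r_right : r @ \oo --> 0^'+.
  move=> P [e /= e0 eP].
  have : \forall k \near \oo, `|r k| < e by apply: cvgr0_norm_lt.
  apply: filterS => k rk; apply: eP => //=.
  by rewrite sub0r normrN.
have : (mu (A `&` ball x (r k)) * (mu (ball x (r k)))^-1)%E @[k --> \oo] --> 1%:E.
  exact: cvg_comp r_right dens.
move=> dens_seq.
have : (1%:E <= (1 - eta)%:E :> \bar R)%E.
  apply: (cvge_to_le dens_seq); near=> k; rewrite lebesgue_measure_ball ?(ltW (r0 k)) //.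
  have rk0 : r k *+ 2 != 0 by rewrite mulrn_eq0 /= gt_eqF.
  rewrite inver (negPf rk0).
  apply: (@le_trans _ _ (((1 - eta) * (r k *+ 2))%:E * ((r k *+ 2)^-1)%:E)%E).
    apply: lee_wpmul2r; last exact: gap.
    by rewrite lee_fin invr_ge0 mulrn_wge0 // ltW.
  by rewrite -EFinM -mulrA mulfV // mulr1.
by rewrite lee_fin; lra.
Unshelve. all: by end_near. Qed.

End density.

(** * Full measure of the approximable set *)

Section proof.
Context {R : realType}.
Local Notation mu := (@lebesgue_measure R).
Variables (beta C : R) (Psi : nat -> R).
Hypothesis beta_gt1 : 1 < beta.
Hypothesis beta_lt2 : beta < 2.
Hypothesis C_gt0 : 0 < C.
Hypothesis digit_sum_gap : forall n (e e' : {ffun 'I_n -> bool}), e != e' ->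
  C / 2 ^+ n <= `|digit_sum beta e - digit_sum beta e'|.
Hypothesis Psi_ge0 : forall n, (1 <= n)%N -> 0 <= Psi n.
Hypothesis Psi_div : (\sum_(1 <= n <oo) (2 ^+ n * Psi n)%:E = +oo)%E.

Let beta_gt0 : 0 < beta. Proof. exact: lt_trans beta_gt1. Qed.

Let D := (beta - 1)^-1 + C.

Lemma measurable_W : measurable (W beta Psi).
Proof.
apply: bigcap_measurable; first by exists 1%N.
move=> m _; apply: bigcup_measurable => n _.
by apply: fin_bigcup_measurable => [|e _]; [exact: finite_finset|exact: measurable_itv].
Qed.

(** [measure_limsup_ge] applied to the words extending [w], with radii truncated
    so as not to exceed half of the separation.  Truncating at [C / 2 ^ m / 2],
    [m = k + n], keeps the divergence and suffices since [beta <= 2].  Taking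
    [0 < k] keeps away from [Psi 0], which may be negative. *)
Lemma W_in_cylinder k (w : {ffun 'I_k -> bool}) : (0 < k)%N ->
  exists G : set R, [/\ measurable G, G `<=` W beta Psi,
    G `<=` `[digit_sum beta w, digit_sum beta w + D / beta ^+ k]%classic &
    ((C / beta ^+ k / 72)%:E <= mu G)%E].
Proof.
move=> k0; set b := C / beta ^+ k.
have b0 : 0 < b by rewrite divr_gt0 ?exprn_gt0.
pose psi n := Num.min (Psi (k + n)%N) (C / 2 ^+ (k + n) / 2).
pose X n := [seq digit_sum beta (cat_word w f) | f <- enum {ffun 'I_n -> bool}].
have sizeX n : size (X n) = (2 ^ n)%N.
  by rewrite size_map -cardE card_ffun card_bool card_ord.
have sepX n : spaced (b / 2 ^+ n) (X n).
  rewrite /spaced pairwise_map; move: (enum_uniq {ffun 'I_n -> bool}).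
  rewrite uniq_pairwise; apply: sub_pairwise => f f' /= ff'.
  rewrite !digit_sum_cat opprD addrACA subrr add0r -mulrBl normrM normfV.
  rewrite (ger0_norm (exprn_ge0 _ (ltW beta_gt0))) /b mulrAC ler_pM2r ?invr_gt0 ?exprn_gt0 //.
  exact: digit_sum_gap.
have psi_le n : psi n <= b / 2 ^+ n / 2.
  apply: (@le_trans _ _ (C / 2 ^+ (k + n) / 2)); first by rewrite ge_min lexx orbT.
  rewrite ler_pM2r // exprD invfM mulrA ler_pM2r ?invr_gt0 ?exprn_gt0 //.
  rewrite ler_pM2l // lef_pV2 ?posrE ?exprn_gt0 //.
  by rewrite lerXn2r ?nnegrE ?ltW.
have psi_bnd n : 0 <= psi n <= b / 2 ^+ n / 2.
  rewrite psi_le andbT le_min Psi_ge0 ?ltn_addr //=.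
  by rewrite !divr_ge0 ?exprn_ge0 // ltW.
have psi_div M A : exists N, A <= \sum_(M <= n < N) 2 ^+ n * psi n.
  have [|||N AN] := @truncated_sum_divergent R (fun n => 2 ^+ n * Psi n) (C / 2)
                      _ _ Psi_div (k + M) (2 ^+ k * A).
  - by rewrite divr_gt0.
  - by move=> n n1; rewrite mulr_ge0 ?exprn_ge0 ?Psi_ge0.
  - by rewrite ltn_addr.
  exists (N - k)%N; rewrite -(ler_pM2l (_ : 0 < 2 ^+ k :> R)) ?exprn_gt0 //.
  apply: le_trans AN _; rewrite addnC big_addn mulr_sumr.
  apply: ler_sum_nat => n _; rewrite (addnC n) mulrA -exprD /psi.
  rewrite -[in leLHS](_ : 2 ^+ (k + n) * (C / 2 ^+ (k + n) / 2) = C / 2).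
    by rewrite minr_pMr ?exprn_ge0.
  by field; rewrite expf_neq0.
have X_bnd n x : x \in X n ->
    digit_sum beta w <= x /\ x + psi n <= digit_sum beta w + D / beta ^+ k.
  move=> /mapP[f _ ->]; rewrite digit_sum_cat.
  have /andP[f0 f1] := digit_sum_bounds beta_gt1 f.
  have bk0 : 0 < beta ^+ k by rewrite exprn_gt0.
  split; first by rewrite lerDl divr_ge0 // ltW.
  rewrite -addrA lerD2l /D mulrDl lerD //; first by rewrite ler_pM2r ?invr_gt0.
  apply: le_trans (psi_le n) _; rewrite -mulrA ler_piMr ?(ltW b0) //.
  rewrite -invfM invf_le1 ?mulr_gt0 ?exprn_gt0 //.
  by rewrite -exprSr exprn_ege1 // ler1n.
exists (\bigcap_M tail X psi M); split.
- apply: bigcapT_measurable => M; apply: bigcup_measurable => n _.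
  exact: measurable_intervals.
- move=> t tG m /= m1; have [n /= mn] := tG m I.
  move=> /mem_intervals[_ /mapP[_ /mapP[f _ ->] ->] /= /andP[t1 t2]].
  exists (k + n)%N; first by rewrite /= (leq_trans mn) // leq_addl.
  exists (cat_word w f) => //=; rewrite in_itv /= t1 (le_trans t2) // lerD2l.
  by rewrite ge_min lexx.
- move=> t /(_ 0%N I)[n _ /mem_intervals[_ /mapP[x xX ->] /= xt]].
  by rewrite /= in_itv /=; have [] := X_bnd n x xX; lra.
- exact: (measure_limsup_ge b0 sizeX sepX psi_bnd psi_div X_bnd).
Qed.

(** The interval around [digit_sum beta w] that contains both [x] and a
    substantial part of [W beta Psi] has half the length of the radius [r k],
    so lies in the ball. *)
Lemma W_full : {ae mu, forall x, I_beta beta x -> W beta Psi x}.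
Proof.
have ae_filter := ae_filter_ringOfSetsType mu.
have D0 : 0 < D by rewrite addr_gt0 ?invr_gt0 ?subr_gt0.
pose r := geometric (2 * D / beta) beta^-1.
have rE k : r k = 2 * (D / beta ^+ k.+1).
  by rewrite /r /= exprVn exprS invfM; ring.
have bk0 k : 0 < beta ^+ k by rewrite exprn_gt0.
have mW := measurable_W.
have : {ae mu, forall x, ~ (I_beta beta `\` W beta Psi) x}.
  (* [eta] is the ratio of [C / beta ^+ k.+1 / 72] to the length [2 * r k]. *)
  apply: (@ae_notin_of_local_gap _ _ (C / (72 * (4 * D))) r) => //.
  - by apply: measurableD => //; exact: measurable_itv.
  - by rewrite divr_gt0 ?mulr_gt0.
  - by move=> k; rewrite rE mulr_gt0 ?divr_gt0.
  - by apply: cvg_geometric; rewrite ger0_norm ?invr_ge0 ?(ltW beta_gt0) // invf_lt1.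
  move=> x k [Ix nWx].
  have [w /andP[w0 w1]] : exists w : {ffun 'I_k.+1 -> bool},
      0 <= x - digit_sum beta w <= (beta - 1)^-1 / beta ^+ k.+1.
    by apply: digit_sum_dense; rewrite ?(ltW beta_lt2) //; move: Ix; rewrite /I_beta /= in_itv.
  have [G [mG GW Gw muG]] := W_in_cylinder w (ltn0Sn k).
  have Dk0 : 0 < D / beta ^+ k.+1 by rewrite divr_gt0.
  have D1 : (beta - 1)^-1 / beta ^+ k.+1 <= D / beta ^+ k.+1.
    by rewrite ler_pM2r ?invr_gt0 // lerDl ltW.
  have GB : G `<=` ball x (r k).
    move=> t /Gw; rewrite /= in_itv /= /ball /= rE ltr_norml; lra.
  set AB := _ `&` ball x (r k).
  have mB : measurable (ball x (r k)).
    exact: measurable_realfun.measurable_ball.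
  have mAB : measurable AB.
    by apply: measurableI; [apply: measurableD => //; exact: measurable_itv|].
  have ABG : AB `&` G = set0.
    by apply/seteqP; split=> // t [[[_ nWt] _] /GW].
  have -> : (1 - C / (72 * (4 * D))) * (r k *+ 2) = r k *+ 2 - C / beta ^+ k.+1 / 72.
    by rewrite rE; field; rewrite !gt_eqF.
  have rk0 : 0 <= r k by rewrite rE mulr_ge0 ?(ltW Dk0).
  rewrite EFinB leeBrDr // -(lebesgue_measure_ball x rk0).
  apply: le_trans (leeD2l _ muG) _.
  have <- : (mu (AB `|` G) = mu AB + mu G)%E by exact: measureU.
  apply: le_measure; rewrite ?inE; [exact: measurableU|exact: mB|].
  by move=> t [[]|/GB].
apply: filterS => x nIW Ix; apply: contrapT => nWx; exact: nIW.
Qed.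

End proof.

Theorem theorem1p2 (R : realType) (beta : R)
    (beta_gt1 : 1 < beta) (beta_lt2 : beta < 2)
    (beta_garsia : garsia_number beta) :
  approximation_regular beta.
Proof.
have [C C0 gap] := garsia_separation beta_garsia.
by move=> Psi Psi0 Psi_div; exact: W_full gap Psi0 Psi_div.
Qed.
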